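(* Let $\Pi$ be a bicriteria minimization problem with positive-valued, polynomially computable objective functions. Given $0<\epsilon\leq 1$ and a polynomial-time $\alpha$-approximation algorithm $\mathrm{ALG}$ for the weighted sum problem $\Pi^{\mathrm{WS}}$, it is possible to compute an $\left(\alpha\cdot(1+2\epsilon),\ \alpha\cdot\left(1+\frac{2}{\epsilon}\right)\right)$-approximate Pareto curve in time $\mathcal{O}\left(T_{\mathrm{ALG}}\cdot\frac{1}{\epsilon}\cdot\log_2\left(\frac{\mathrm{UB}(1)\cdot\mathrm{UB}(2)}{\mathrm{LB}(1)\cdot\mathrm{LB}(2)}\right)\right)$, where $T_{\mathrm{ALG}}$ denotes the running time of $\mathrm{ALG}$.
   Context: Bicriteria minimization problem $\Pi$: each instance $I$ has a set $S(I)$ of feasible solutions, and two objective functions to be minimized are given by polynomial-time algorithms $f_1,f_2$ that, given $I$ and $x\in S(I)$, compute positive rational numbers $f_1(I,x), f_2(I,x)$. For each instance $I$ and $i=1,2$ there are positive rationals $\mathrm{LB}(I,i),\mathrm{UB}(I,i)$, of encoding length polynomial in the encoding length $|I|$, with $\mathrm{LB}(I,i)\le f_i(I,x)\le \mathrm{UB}(I,i)$ for all $x\in S(I)$; these bounds may be used by the algorithms. The instance $I$ is dropped from the notation when clear (so $\mathrm{LB}(i)=\mathrm{LB}(I,i)$, $\mathrm{UB}(i)=\mathrm{UB}(I,i)$). Weighted sum problem $\Pi^{\mathrm{WS}}$: given an instance $I$ and a weight $\gamma>0$, find $x\in S(I)$ minimizing $f_1(I,x)+\gamma\cdot f_2(I,x)$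 over $S(I)$. Polynomial-time $\alpha$-approximation algorithm ($\alpha\ge 1$) for a minimization problem: an algorithm that, for any given instance, in time polynomial in the encoding length of the instance, finds a feasible solution with objective value at most $\alpha$ times the optimal objective value if a feasible solution exists, and outputs infeasibility otherwise. For $\alpha',\beta'\ge1$, an $(\alpha',\beta')$-approximate Pareto curve for an instance $I$ is a set $P$ of feasible solutions such that for every $x\in S(I)$ there exists $x'\in P$ with $f_1(I,x')\le\alpha'\cdot f_1(I,x)$ and $f_2(I,x')\le\beta'\cdot f_2(I,x)$.
   Formalization: The logarithmic factor in the running time is replaced by max(1, log2 of the ratio), since the stated bound is 0 when upper and lower bounds coincide; ε is a rational input, and running time counts unit-cost arithmetic steps with polynomial encoding lengths. *)

(* Defs.v *)
From mathcomp Require Import all_boot all_order all_algebra.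
From mathcomp Require Import all_classical all_reals all_analysis.

Set Implicit Arguments.
Unset Strict Implicit.
Unset Printing Implicit Defensive.
Import Order.TTheory GRing.Theory Num.Theory.
Local Open Scope classical_set_scope.
Local Open Scope ring_scope.

(* Algorithms are programs of the arithmetic model of computation: every
   elementary operation, including rational arithmetic and comparison, takes
   one step, and encoding lengths of the values that are produced are recorded
   separately.  As usual in this model, "polynomial time" means polynomially
   many steps on values of polynomial encoding length. *)

Inductive value : Type :=
| Nil
| Num of rat
| Pair of value & value.

Definition bit_length (n : nat) : nat := (trunc_log 2 n).+1.

(* The extra bit is the sign. *)
Definition rat_length (q : rat) : nat :=
  (1 + bit_length `|numq q| + bit_length `|denq q|)%N.

Fixpoint length (v : value) : nat :=
  match v with
  | Nil => 1
  | Num q => rat_length q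
  | Pair a b => (1 + length a + length b)%N
  end.

Definition enc_list (s : seq value) : value := foldr Pair Nil s.

(* [Nil] is the only false value.  Unary operations ignore their second
   argument; an operation applied to values of the wrong shape yields [Nil]. *)
Definition truthy (v : value) : bool := if v is Nil then false else true.

Definition of_bool (b : bool) : value := if b then Num 1 else Nil.

Inductive op : Type := Add | Sub | Mul | Div | Le | Cons | Car | Cdr | IsPair | Copy.

Definition eval_op (o : op) (u v : value) : value :=
  match o, u, v with
  | Add, Num p, Num q => Num (p + q)
  | Sub, Num p, Num q => Num (p - q)
  | Mul, Num p, Num q => Num (p * q)
  | Div, Num p, Num q => Num (p / q)
  | Le, Num p, Num q => of_bool (p <= q)
  | Cons, _, _ => Pair u v
  | Car, Pair a _, _ => a
  | Cdr, Pair _ b, _ => b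
  | IsPair, Pair _ _, _ => of_bool true
  | Copy, _, _ => u
  | _, _, _ => Nil
  end.

(* [Call x A y] runs the program [A] as a subroutine, in a store of its own,
   on the content of register [y], and puts its result in register [x]. *)
Inductive program : Type :=
| Skip
| Const (x : nat) (v : value)
| Op (x : nat) (o : op) (y z : nat)
| Seq (A B : program)
| If (x : nat) (A B : program)
| While (x : nat) (A : program)
| Call (x : nat) (A : program) (y : nat).

Definition store : Type := nat -> value.

Definition upd (s : store) (x : nat) (v : value) : store :=
  fun y => if y == x then v else s y.

Definition init (v : value) : store := upd (fun=> Nil) 0 v.

(* [exec A s s' t m]: from store [s], [A] halts in store [s'] after [t] steps,
   and [m] is the largest encoding length of a value assigned on the way. *)
Inductive exec : program -> store -> store -> nat -> nat -> Prop :=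
| ExecSkip s : exec Skip s s 1 0
| ExecConst s x v : exec (Const x v) s (upd s x v) 1 (length v)
| ExecOp s x o y z :
    exec (Op x o y z) s (upd s x (eval_op o (s y) (s z)))
         1 (length (eval_op o (s y) (s z)))
| ExecSeq A B s s1 s2 t1 t2 m1 m2 :
    exec A s s1 t1 m1 -> exec B s1 s2 t2 m2 ->
    exec (Seq A B) s s2 (t1 + t2) (maxn m1 m2)
| ExecIfTrue x A B s s' t m :
    truthy (s x) -> exec A s s' t m -> exec (If x A B) s s' t.+1 m
| ExecIfFalse x A B s s' t m :
    ~~ truthy (s x) -> exec B s s' t m -> exec (If x A B) s s' t.+1 m
| ExecWhileFalse x A s :
    ~~ truthy (s x) -> exec (While x A) s s 1 0
| ExecWhileTrue x A s s1 s2 t1 t2 m1 m2 :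
    truthy (s x) -> exec A s s1 t1 m1 -> exec (While x A) s1 s2 t2 m2 ->
    exec (While x A) s s2 (t1 + t2).+1 (maxn m1 m2)
| ExecCall x A y s s' t m :
    exec A (init (s y)) s' t m ->
    exec (Call x A y) s (upd s x (s' 0%N)) t.+1 m.

(* Input and output are passed in register 0. *)
Definition runs (A : program) (input output : value) (t m : nat) : Prop :=
  exists2 s, exec A (init input) s t m & s 0%N = output.

(* [A] solves in polynomial time the problem whose inputs are the elements of
   [D] and for which the admissible outputs on input [v] are [spec v]. *)
Definition polytime_solves (A : program) (D : set value)
    (spec : value -> set value) : Prop :=
  exists p : {poly nat}, forall v, D v ->
    exists r t m, [/\ runs A v r t m, spec v r,
                      (t <= p.[length v])%N & (m <= p.[length v])%N].

(* Instances and solutions are identified with their encodings.  The index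
   [ord0] stands for the first objective, [ord_max] for the second one. *)
Record bicriteria_problem : Type := BicriteriaProblem {
  instance : set value;
  feasible : value -> set value;
  obj : 'I_2 -> value -> value -> rat;
  LB : 'I_2 -> value -> rat;
  UB : 'I_2 -> value -> rat;
  obj_gt0 : forall i I x, instance I -> feasible I x -> 0 < obj i I x;
  obj_polytime : forall i, exists A,
    polytime_solves A
      [set v | exists I x, [/\ instance I, feasible I x & v = Pair I x]]
      (fun v => [set r | exists I x, v = Pair I x /\ r = Num (obj i I x)]);
  LB_gt0 : forall i I, instance I -> 0 < LB i I;
  UB_gt0 : forall i I, instance I -> 0 < UB i I;
  LB_length : forall i, exists p : {poly nat}, forall I, instance I ->
    (rat_length (LB i I) <= p.[length I])%N;
  UB_length : forall i, exists p : {poly nat}, forall I, instance I ->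
    (rat_length (UB i I) <= p.[length I])%N;
  obj_bounds : forall i I x, instance I -> feasible I x ->
    LB i I <= obj i I x <= UB i I
}.

Section Problem.
Variables (R : realType) (P : bicriteria_problem).

Definition f1 : value -> value -> rat := obj P ord0.
Definition f2 : value -> value -> rat := obj P ord_max.

(* The bounds may be used by algorithms, so they come with the instance. *)
Definition instance_data (I : value) : value :=
  enc_list [:: I; Num (LB P ord0 I); Num (UB P ord0 I);
                  Num (LB P ord_max I); Num (UB P ord_max I)].

Definition weighted_sum (I : value) (gamma : rat) (x : value) : rat :=
  f1 I x + gamma * f2 I x.

(* The infimum rather than the minimum, because [feasible P I] need not be
   finite. *)
Definition weighted_sum_opt (I : value) (gamma : rat) : R :=
  inf [set ratr (weighted_sum I gamma x) | x in feasible P I].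

Definition weighted_sum_input (I : value) (gamma : rat) : value :=
  Pair (instance_data I) (Num gamma).

(* A solution [x] is returned as the list [x], infeasibility as the empty
   list. *)
Definition weighted_sum_approx (alpha : R) (I : value) (gamma : rat) :
    set value :=
  [set r | (feasible P I !=set0 /\
            exists x, [/\ r = enc_list [:: x], feasible P I x &
              ratr (weighted_sum I gamma x)
                <= alpha * weighted_sum_opt I gamma])
           \/ (feasible P I = set0 /\ r = enc_list [::])].

Definition weighted_sum_approx_algorithm (alpha : R) (ALG : program) : Prop :=
  polytime_solves ALG
    [set v | exists I gamma,
       [/\ instance P I, 0 < gamma & v = weighted_sum_input I gamma]]
    (fun v => [set r | forall I gamma,
       instance P I -> v = weighted_sum_input I gamma ->
       weighted_sum_approx alpha I gamma r]).

(* [T] bounds the running time of [ALG] on the instance [I] for all weights of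
   encoding length at most [n]. *)
Definition running_time_bound (ALG : program) (I : value) (n T : nat) : Prop :=
  forall gamma r t m, 0 < gamma -> (rat_length gamma <= n)%N ->
    runs ALG (weighted_sum_input I gamma) r t m -> (t <= T)%N.

Definition approx_pareto_curve (a b : R) (I : value) (C : set value) : Prop :=
  C `<=` feasible P I /\
  forall x, feasible P I x ->
    exists x', [/\ C x', ratr (f1 I x') <= a * ratr (f1 I x)
                       & ratr (f2 I x') <= b * ratr (f2 I x)].

Definition pareto_input (I : value) (eps : rat) : value :=
  Pair (instance_data I) (Num eps).

Definition log2 (x : R) : R := ln x / ln 2.

Definition bound_ratio (I : value) : rat :=
  (UB P ord0 I * UB P ord_max I) / (LB P ord0 I * LB P ord_max I).

End Problem.

(* Main.v *)
Require Import Defs.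
From mathcomp Require Import all_boot all_order all_algebra.
From mathcomp Require Import all_classical all_reals all_analysis.
From Stdlib Require List.
From mathcomp Require Import ring lra zify.
Import Order.TTheory GRing.Theory Num.Theory.
Local Open Scope classical_set_scope.
Local Open Scope ring_scope.

(* For a solution x, put r = f1(x)/f2(x).  An alpha-approximation x' for a weight
   w with eps r / 2 <= w <= eps r satisfies
   f1(x') + w f2(x') <= alpha (f1(x) + w f2(x)), and bounding w f2(x) by
   eps f1(x), respectively f1(x) by (2/eps) w f2(x), gives both required factors.
   As LB(1)/UB(2) <= r <= UB(1)/LB(2), such a w occurs among the weights
   2^i eps LB(1)/UB(2) that are at most eps UB(1)/LB(2).  There are at most
   1 + log2 (UB(1)UB(2) / (LB(1)LB(2))) of them, so no factor 1/eps is lost. *)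

(** * Encoding lengths *)

(* Unlike [rat_length], this size is additive under products without
   normalizing the fraction. *)
Definition fits (n : nat) (x : rat) : Prop :=
  exists a b : nat, [/\ x = a%:R / b%:R, (0 < a < 2 ^ n)%N & (0 < b < 2 ^ n)%N].

Lemma bit_length_leq (n a : nat) :
  (0 < a)%N -> (a < 2 ^ n)%N -> (bit_length a <= n)%N.
Proof.
move=> a_gt0 ltan; rewrite /bit_length -(@ltn_exp2l 2) //.
exact: leq_ltn_trans (trunc_logP _ a_gt0) ltan.
Qed.

Lemma ltn_bit_length (n : nat) : (n < 2 ^ bit_length n)%N.
Proof. exact: trunc_log_ltn. Qed.

(** [numq] and [denq] belong to the reduced fraction; the factor [k] is what the reduction
    cancels. *)
Lemma divq_common_factor (n d : int) : d != 0 ->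
  exists2 k : int, k != 0 &
    n = k * numq (n%:~R / d%:~R) /\ d = k * denq (n%:~R / d%:~R).
Proof. by case: divqP => [d0|k x k0 _] //; exists k. Qed.

(** Reduction cancels a common nonzero integer, so it only shrinks both parts; [(n + n).+1] counts
    two bit lengths and the sign. *)
Lemma fits_rat_length (n : nat) (x : rat) :
  fits n x -> (rat_length x <= (n + n).+1)%N.
Proof.
case=> a [b [-> /andP[a_gt0 ltan] /andP[b_gt0 ltbn]]].
have b0 : (b : int) != 0 by lia.
have [k k0 [ea eb]] := divq_common_factor a b b0.
set y := a%:~R / b%:~R in ea eb; rewrite -[a%:R / b%:R]/y.
have [k1 num_gt0] : (0 < `|k|)%N /\ (0 < `|numq y|)%N.
  split; first by lia.
  case: (posnP `|numq y|) => // num0.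
  by move: ea; rewrite (_ : numq y = 0); lia.
have num_le : (`|numq y| <= a)%N.
  by rewrite -[a]/(`|a%:Z|)%N ea abszM leq_pmull.
have den_le : (`|denq y| <= b)%N.
  by rewrite -[b]/(`|b%:Z|)%N eb abszM leq_pmull.
rewrite /rat_length; have := @bit_length_leq n `|numq y| num_gt0.
have := @bit_length_leq n `|denq y|; lia.
Qed.

Lemma rat_length_fits (x : rat) : 0 < x -> fits (rat_length x) x.
Proof.
move=> x_gt0; exists `|numq x|%N, `|denq x|%N.
have num_gt0 : 0 < numq x by rewrite numq_gt0.
have den_gt0 := denq_gt0 x.
split.
- rewrite !pmulrn !gez0_abs ?ltW //; exact/esym/divq_num_den.
- apply/andP; split; first by lia.
  apply: leq_trans (ltn_bit_length _) _; rewrite leq_exp2l // /rat_length; lia.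
- apply/andP; split; first by lia.
  apply: leq_trans (ltn_bit_length _) _; rewrite leq_exp2l // /rat_length; lia.
Qed.

Lemma fitsM (m n : nat) (x y : rat) :
  fits m x -> fits n y -> fits (m + n) (x * y).
Proof.
move=> [a [b [-> /andP[a0 am] /andP[b0 bm]]]].
move=> [c [d [-> /andP[c0 cn] /andP[d0 dn]]]].
exists (a * c)%N, (b * d)%N; split.
- by rewrite !natrM mulf_div.
- by rewrite muln_gt0 a0 c0 expnD ltn_mul.
- by rewrite muln_gt0 b0 d0 expnD ltn_mul.
Qed.

Lemma fitsV (n : nat) (x : rat) : fits n x -> fits n x^-1.
Proof. by move=> [a [b [-> ? ?]]]; exists b, a; rewrite invf_div. Qed.

(** Only the numerator grows, so a doubling costs a single bit. This keeps the encoding length of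
    the weights linear in their index. *)
Lemma fits_double (n : nat) (x : rat) : fits n x -> fits n.+1 (x + x).
Proof.
move=> [a [b [-> /andP[a0 an] /andP[b0 bn]]]]; exists (a + a)%N, b; split.
- by rewrite natrD mulrDl.
- rewrite expnS; lia.
- rewrite expnS; lia.
Qed.

Lemma fits_leq (m n : nat) (x : rat) : (m <= n)%N -> fits m x -> fits n x.
Proof.
move=> lemn [a [b [-> /andP[a0 an] /andP[b0 bn]]]]; exists a, b.
have lemn2 : (2 ^ m <= 2 ^ n)%N by rewrite leq_exp2l.
by split=> //; lia.
Qed.

(** The denominator is at least 1. Applied to the ratio of the extreme weights, this bounds the
    number of doublings by an encoding length. *)
Lemma fits_ltr (n : nat) (x : rat) : fits n x -> x < 2 ^+ n.
Proof.
move=> [a [b [-> /andP[_ an] /andP[b0 _]]]].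
have b1 : 1 <= b%:R :> rat by rewrite ler1n.
apply: (@le_lt_trans _ _ a%:R); last by rewrite -natrX ltr_nat.
by rewrite ler_pdivrMr ?ltr0n // ler_peMr.
Qed.

(** * Program executions *)

Lemma length_gt0 (v : value) : (0 < length v)%N.
Proof. by case: v. Qed.

Lemma rat_length1 : rat_length 1 = 3%N.
Proof. by []. Qed.

Lemma length_of_bool (b : bool) : (length (of_bool b) <= 3)%N.
Proof. by case: b. Qed.

(* [m] alone does not bound the result: [Call x Skip y] copies a register
   without assigning any value inside the subroutine. *)
Lemma exec_length (A : program) (s s' : store) (t m n : nat) :
  exec A s s' t m -> (forall x, length (s x) <= n)%N ->
  forall x, (length (s' x) <= maxn n m)%N.
Proof.
move=> e; elim: e n => {A s s' t m}.
- by move=> s n sn x; rewrite maxn0.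
- move=> s x v n sn y; rewrite /upd; case: eqP => _; have := sn y; lia.
- by move=> s x o y z n sn w; rewrite /upd; case: eqP => _; have := sn w; lia.
- move=> A B s s1 s2 t1 t2 m1 m2 _ IH1 _ IH2 n sn x.
  by rewrite maxnA; apply: IH2; apply: IH1.
- by move=> x A B s s' t m _ _ IH n sn y; apply: IH.
- by move=> x A B s s' t m _ _ IH n sn y; apply: IH.
- by move=> x A s _ n sn y; rewrite maxn0.
- move=> x A s s1 s2 t1 t2 m1 m2 _ _ IH1 _ IH2 n sn y.
  by rewrite maxnA; apply: IH2; apply: IH1.
- move=> x A y s s' t m _ IH n sn z; rewrite /upd; case: eqP => _; last first.
    by have := sn z; lia.
  apply: IH => w; rewrite /init /upd; case: eqP => _ //.
  exact: leq_trans (length_gt0 (s y)) (sn y).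
Qed.

Lemma runs_length (A : program) (v r : value) (t m : nat) :
  runs A v r t m -> (length r <= maxn (length v) m)%N.
Proof.
move=> [s e <-]; apply: (exec_length _ _ _ _ _ _ e) => x.
by rewrite /init /upd; case: eqP => // _; apply: length_gt0.
Qed.

Lemma exec_gt0 (A : program) (s s' : store) (t m : nat) :
  exec A s s' t m -> (0 < t)%N.
Proof. by elim=> *; lia. Qed.

(** Trading the exact maximum for an upper bound lets commands be composed under one common [M]. *)
Definition bounded_exec (A : program) (s s' : store) (t M : nat) : Prop :=
  exists2 m, exec A s s' t m & (m <= M)%N.

Lemma bounded_exec_op (x : nat) (o : op) (y z : nat) (s : store) (M : nat) :
  (length (eval_op o (s y) (s z)) <= M)%N ->
  bounded_exec (Op x o y z) s (upd s x (eval_op o (s y) (s z))) 1 M.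
Proof. by move=> le; eexists; [apply: ExecOp | exact: le]. Qed.

Lemma bounded_exec_seq (A B : program) (s s1 s2 : store) (t1 t2 M : nat) :
  bounded_exec A s s1 t1 M -> bounded_exec B s1 s2 t2 M ->
  bounded_exec (Seq A B) s s2 (t1 + t2) M.
Proof.
move=> [m1 e1 le1] [m2 e2 le2]; exists (maxn m1 m2); first exact: ExecSeq e1 e2.
by rewrite geq_max le1.
Qed.

Lemma bounded_exec_op_seq (x : nat) (o : op) (y z : nat) (A : program)
    (s s' : store) (v : value) (t M : nat) :
  eval_op o (s y) (s z) = v -> (length v <= M)%N ->
  bounded_exec A (upd s x v) s' t M ->
  bounded_exec (Seq (Op x o y z) A) s s' t.+1 M.
Proof.
move=> <- len_v execA; rewrite -add1n.
exact: bounded_exec_seq (bounded_exec_op _ _ _ _ _ _ len_v) execA.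
Qed.

(** * The program and its loop invariant *)

Definition seq_programs (As : seq program) : program := foldr Seq Skip As.

(* Registers: 0 the list of solutions found so far, 1 the instance data, 3 the
   loop condition, 4 the current weight, 5 the largest weight. *)
Definition collect_one (ALG : program) : program :=
  seq_programs [:: Op 8 Defs.Cons 1 4; Call 9 ALG 8;
                If 9 (Seq (Op 9 Car 9 9) (Op 0 Defs.Cons 9 0)) Skip;
                Op 4 Add 4 4; Op 3 Le 4 5].

(** Register 2 receives [eps], 6 and 7 receive LB(2) and UB(2), and 3 walks along the instance data.
    The quotients then leave eps LB(1)/UB(2) in 4 and eps UB(1)/LB(2) in 5. *)
Definition prepare : program :=
  seq_programs [:: Op 1 Car 0 0; Op 2 Cdr 0 0;
                Op 3 Cdr 1 1; Op 4 Car 3 3; Op 3 Cdr 3 3; Op 5 Car 3 3;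
                Op 3 Cdr 3 3; Op 6 Car 3 3; Op 3 Cdr 3 3; Op 7 Car 3 3;
                Op 4 Mul 2 4; Op 4 Div 4 7; Op 5 Mul 2 5; Op 5 Div 5 6;
                Const 0 Defs.Nil; Op 3 Le 4 5].

Definition pareto_curve (ALG : program) : program :=
  Seq prepare (While 3 (collect_one ALG)).

(** Two length bounds are kept apart: [M] for the data of a single call of [ALG], and [N] for all
    assigned values, including the accumulated list, which grows by at most [M] per round. *)
Lemma collect_oneP (ALG : program) (D : value) (g h : rat) (C : seq value)
    (r : value) (s : store) (t m M N : nat) :
  [/\ s 0%N = enc_list C, s 1%N = D, s 4%N = Defs.Num g & s 5%N = Defs.Num h] ->
  runs ALG (Pair D (Defs.Num g)) r t m -> (m <= M)%N ->
  (length (Pair D (Defs.Num g)) <= M)%N -> (rat_length (g + g) <= M)%N ->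
  (length (enc_list C) + M + 3 <= N)%N ->
  r = enc_list [::] \/ (exists x, r = enc_list [:: x]) ->
  exists C' s' t',
    [/\ bounded_exec (collect_one ALG) s s' t' N, (t' <= t + 8)%N,
        [/\ s' 0%N = enc_list C', s' 1%N = D, s' 4%N = Defs.Num (g + g),
            s' 5%N = Defs.Num h & s' 3%N = of_bool (g + g <= h)],
        (length (enc_list C') <= length (enc_list C) + M)%N &
        forall x, List.In x C' <-> List.In x C \/ r = enc_list [:: x]].
Proof.
move=> [s0 s1 s4 s5] run mM DM gM leN r_shape.
have rM : (length r <= M)%N by have := runs_length _ _ _ _ _ run; lia.
pose sa := upd s 8%N (Pair D (Defs.Num g)); pose sb := upd sa 9%N r.
have exec_a : bounded_exec (Op 8 Defs.Cons 1 4) s sa 1 N.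
  rewrite /sa -[Pair D _]/(eval_op Defs.Cons D (Defs.Num g)) -s1 -s4.
  by apply: bounded_exec_op; rewrite s1 s4; apply: leq_trans DM _; lia.
have exec_b : bounded_exec (Call 9 ALG 8) sa sb t.+1 N.
  case: run => s' e s'0; exists m; last by lia.
  rewrite /sb -s'0.
  exact: (@ExecCall 9 ALG 8 sa _ _ _ e).
have [C' [sc [tc [exec_c tc2 [sc0 frame_c] lenC' inC']]]] : exists C' sc tc,
    [/\ bounded_exec (If 9 (Seq (Op 9 Car 9 9) (Op 0 Defs.Cons 9 0)) Skip) sb sc tc N,
        (tc <= 3)%N, sc 0%N = enc_list C' /\
        (forall y, y \in [:: 1; 4; 5]%N -> sc y = s y),
        (length (enc_list C') <= length (enc_list C) + M)%N
      & forall x, List.In x C' <-> List.In x C \/ r = enc_list [:: x]].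
  (* The empty list is encoded by [Nil], the only false value, so the conditional separates
     infeasibility from a returned solution. *)
  case: r_shape => [r_nil | [x r_x]].
    exists C, sb, 2%N; split=> //.
    - exists 0%N => //; apply: ExecIfFalse; last exact: ExecSkip.
      by rewrite /sb /upd /= r_nil.
    - by split=> // y; rewrite !inE => /or3P[] /eqP ->.
    - by rewrite leq_addr.
    - by move=> x; split=> [|[//|]]; [left | rewrite r_nil].
  pose sd := upd sb 9%N x; pose se := upd sd 0%N (enc_list (x :: C)).
  have lenx : (length x + 2 <= M)%N by move: rM; rewrite r_x /=; lia.
  have exec_d : bounded_exec (Op 9 Car 9 9) sb sd 1 N.
    rewrite /sd -[x]/(eval_op Car (enc_list [:: x]) (enc_list [:: x])) -r_x.
    by apply: (bounded_exec_op 9 Car 9 9 sb); rewrite /sb /upd /= r_x /=; lia.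
  have exec_e : bounded_exec (Op 0 Defs.Cons 9 0) sd se 1 N.
    rewrite /se -[enc_list (x :: C)]/(eval_op Defs.Cons x (enc_list C)) -s0.
    by apply: (bounded_exec_op 0 Defs.Cons 9 0 sd); rewrite /sd /sb /sa /upd /= s0; lia.
  exists (x :: C), se, 3%N; split=> //=.
  - have [m' e' lem'] := bounded_exec_seq _ _ _ _ _ _ _ _ exec_d exec_e.
    by exists m' => //; apply: ExecIfTrue; rewrite // /sb /upd /= r_x.
  - by split=> // y; rewrite !inE => /or3P[] /eqP ->.
  - by lia.
  - move=> y; rewrite r_x; split=> [[->|yC]|[yC|[->]]]; first by right.
    + by left.
    + by right.
    + by left.
pose sf := upd sc 4%N (Defs.Num (g + g)).
have [c1 c4 c5] : [/\ sc 1%N = D, sc 4%N = Defs.Num g & sc 5%N = Defs.Num h].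
  by rewrite !frame_c.
have exec_f : bounded_exec (Op 4 Add 4 4) sc sf 1 N.
  rewrite /sf -[Defs.Num (g + g)]/(eval_op Add (Defs.Num g) (Defs.Num g)) -c4.
  by apply: bounded_exec_op; rewrite c4 /=; lia.
have exec_g : bounded_exec (Op 3 Le 4 5) sf (upd sf 3%N (of_bool (g + g <= h))) 1 N.
  rewrite -[of_bool _]/(eval_op Le (Defs.Num (g + g)) (Defs.Num h)) -c5.
  apply: (bounded_exec_op 3 Le 4 5 sf); rewrite /sf /upd /= c5 /=.
  by apply: leq_trans (length_of_bool _) _; lia.
(* The count is at most 1 + (t + 1) + 3 + 1 + 1 + 1 = t + 8, the last step being the closing
   [Skip]. *)
exists C', (upd sf 3%N (of_bool (g + g <= h))), (1 + (t.+1 + (tc + (1 + (1 + 1)))))%N.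
split=> //; first 2 [by lia].
do 5! [apply: bounded_exec_seq; first by eassumption].
by exists 0%N; [apply: ExecSkip|].
Qed.

(** Induction on the number of rounds: after one round the hypothesis is applied to the shifted
    sequence [w i.+1] and the enlarged list, which is why [w] and [C] are general. Weight [w k] is
    computed but never passed to [ALG], whence the two ranges of [i]. A round costs at most [T + 9]
    steps, the ninth extra one being the loop test. *)
Lemma while_collectP (ALG : program) (D : value) (Q : rat -> value -> Prop) (h : rat)
    (M N k : nat) (w : nat -> rat) (C : seq value) (s : store) :
  (forall i, w i.+1 = w i + w i) ->
  (forall i, (i < k)%N -> w i <= h) -> h < w k ->
  (forall g r, Q g r -> r = enc_list [::] \/ exists x, r = enc_list [:: x]) ->
  (forall i, (i < k)%N -> exists r t m,
     [/\ runs ALG (Pair D (Defs.Num (w i))) r t m, Q (w i) r & (m <= M)%N]) ->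
  (forall i, (i <= k)%N -> (length (Pair D (Defs.Num (w i))) <= M)%N) ->
  [/\ s 0%N = enc_list C, s 1%N = D, s 4%N = Defs.Num (w 0%N), s 5%N = Defs.Num h
     & s 3%N = of_bool (w 0%N <= h)] ->
  (length (enc_list C) + k * M + 3 <= N)%N ->
  exists C' s' t,
    [/\ bounded_exec (While 3 (collect_one ALG)) s s' t N, s' 0%N = enc_list C',
        [/\ forall x, List.In x C -> List.In x C',
            forall x, List.In x C' ->
              List.In x C \/ exists2 i, (i < k)%N & Q (w i) (enc_list [:: x])
          & forall i, (i < k)%N -> exists2 r, Q (w i) r &
              forall x, r = enc_list [:: x] -> List.In x C']
      & forall T, (forall i r t m, (i < k)%N ->
                     runs ALG (Pair D (Defs.Num (w i))) r t m -> (t <= T)%N) ->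
          (t <= 1 + k * (T + 9))%N].
Proof.
elim: k w C s => [|k IH] w C s wS w_le w_gt Q_shape run_w len_w.
  move=> [s0 s1 s4 s5 s3] leN; exists C, s, 1%N; split=> //.
  - exists 0%N => //; apply: ExecWhileFalse.
    by rewrite s3 leNgt w_gt.
  - by split=> // x; left.
move=> [s0 s1 s4 s5 s3] leN.
have [r [t [m [run Qr mM]]]] := run_w 0%N isT.
have len1 : (rat_length (w 0%N + w 0%N) <= M)%N.
  by have := len_w 1%N isT; rewrite /= wS; lia.
have leN1 : (length (enc_list C) + M + 3 <= N)%N by lia.
have [C1 [s' [t' [[m1 e1 m1N] t'9 [s'0 s'1 s'4 s'5 s'3] lenC1 inC1]]]] :=
  collect_oneP ALG D _ h C r s t m M N (And4 s0 s1 s4 s5) run mM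
    (len_w 0%N isT) len1 leN1 (Q_shape _ _ Qr).
rewrite -wS in s'4 s'3.
have [C2 [s'' [t'' [[m2 e2 m2N] s''0 [subC2 C2sub C2Q] t''T]]]] :=
  IH (fun i => w i.+1) C1 s' (fun i => wS i.+1) (fun i => w_le i.+1) w_gt Q_shape
    (fun i => run_w i.+1) (fun i => len_w i.+1) (And5 s'0 s'1 s'4 s'5 s'3) ltac:(lia).
exists C2, s'', (t' + t'').+1; split=> //.
- exists (maxn m1 m2); last by rewrite geq_max m1N.
  by apply: ExecWhileTrue e1 e2; rewrite s3 w_le.
- split.
  + by move=> x xC; apply: subC2; apply/inC1; left.
  + move=> x /C2sub[/inC1[|r_x]|[i ik Qi]]; [by left | right | by right; exists i.+1].
    by exists 0%N; rewrite // -r_x.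
  + case=> [_|i ik]; last exact: C2Q.
    by exists r => // x r_x; apply: subC2; apply/inC1; right.
- move=> T T_ge; have := T_ge 0%N _ _ _ isT run.
  have := t''T T (fun i r t m ik => T_ge i.+1 r t m ik); lia.
Qed.

Lemma prepareP (I : value) (l1 u1 l2 u2 e : rat) (N : nat) :
  let v := Pair (enc_list [:: I; Defs.Num l1; Defs.Num u1; Defs.Num l2; Defs.Num u2])
                (Defs.Num e) in
  (length v + 3 <= N)%N ->
  (rat_length (e * l1) <= N)%N -> (rat_length (e * l1 / u2) <= N)%N ->
  (rat_length (e * u1) <= N)%N -> (rat_length (e * u1 / l2) <= N)%N ->
  exists2 s, bounded_exec prepare (init v) s 17 N &
    [/\ s 0%N = enc_list [::],
        s 1%N = enc_list [:: I; Defs.Num l1; Defs.Num u1; Defs.Num l2; Defs.Num u2],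
        s 4%N = Defs.Num (e * l1 / u2), s 5%N = Defs.Num (e * u1 / l2)
      & s 3%N = of_bool (e * l1 / u2 <= e * u1 / l2)].
Proof.
move=> v lenv len1 len2 len3 len4; rewrite /v /= in lenv.
(* The final store is found by symbolic execution of the sixteen commands and the closing [Skip];
   its registers are then read off by computation. *)
eexists.
  rewrite /prepare.
  do 14! [apply: bounded_exec_op_seq;
    [reflexivity | by rewrite /=; lia | rewrite [eval_op _ _ _]/=]].
  apply: (@bounded_exec_seq _ _ _ _ _ 1 2).
    by eexists; [apply: ExecConst | rewrite /=; lia].
  apply: bounded_exec_op_seq; [reflexivity | | ].
    by apply: leq_trans (length_of_bool _) _; lia.
  by exists 0%N; [apply: ExecSkip|].
by split.
Qed.

(** The coefficients are natural numbers; hence a polynomial bound may be evaluated at an upper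
    bound for the input length. *)
Lemma horner_nat_leq (p : {poly nat}) (m n : nat) :
  (m <= n)%N -> (p.[m] <= p.[n])%N.
Proof.
move=> lemn; rewrite !horner_coef; apply: leq_sum => i _.
apply: leq_mul => //; elim: (i : nat) => // j IH; rewrite !exprS.
exact: leq_mul.
Qed.

(** * Geometric weights *)

(** The pairs [(a, b)] and [(a', b')] are the objective values of a solution and of the approximate
    one. Dropping [w * b'] gives the first bound, even with [1 + e]; dropping [a'] and dividing by
    [w] gives the second. *)
Lemma weighted_sum_tradeoff (R : realFieldType) (alpha a b a' b' w e : R) :
  0 <= alpha -> 0 < w -> 0 < e -> 0 <= a' -> 0 <= b' ->
  a' + w * b' <= alpha * (a + w * b) -> w * b <= e * a -> e * a <= 2 * w * b ->
  a' <= alpha * (1 + 2 * e) * a /\ b' <= alpha * (1 + 2 / e) * b.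
Proof.
move=> alpha0 w0 e0 a'0 b'0 opt wb_le ea_le.
have ea0 : 0 <= e * a by lra.
split.
  have h : alpha * (a + w * b) <= alpha * (a + e * a) by rewrite ler_wpM2l //; lra.
  have h' : 0 <= alpha * (e * a) by rewrite mulr_ge0.
  have wb'0 : 0 <= w * b' by rewrite mulr_ge0 // ltW.
  by rewrite -subr_ge0; lra.
have a_le : a <= 2 / e * (w * b).
  by rewrite mulrAC ler_pdivlMr // mulrC mulrA.
have h : alpha * (a + w * b) <= alpha * (2 / e * (w * b) + w * b).
  by rewrite ler_wpM2l //; lra.
rewrite -(ler_pM2l w0); move: h; set y := 2 / e => h; lra.
Qed.

(** A discrete intermediate value argument; for a doubling sequence it locates [x] within a factor
    2. *)
Lemma sequence_crossing (R : realDomainType) (w : nat -> R) (x : R) (k : nat) :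
  w 0%N <= x -> x < w k -> exists2 i, (i < k)%N & w i <= x < w i.+1.
Proof.
move=> w0; elim: k => [|k IH] ltx; first by move: w0; rewrite leNgt ltx.
have [/IH[i ik wi]|lex] := ltP x (w k); first by exists i => //; apply: ltnW.
by exists k; rewrite // lex ltx.
Qed.

Lemma number_of_weights (g h : rat) (n : nat) : 0 < g -> fits n (h / g) ->
  exists k, [/\ (k <= n)%N, forall i, (i < k)%N -> g * 2 ^+ i <= h
              & h < g * 2 ^+ k].
Proof.
move=> g0 /fits_ltr; rewrite ltr_pdivrMr // mulrC => lt_n.
(* The least overshooting exponent is taken: [n] bounds it, and minimality keeps all earlier weights
   at most [h]. *)
have ex_k : exists k, h < g * 2 ^+ k by exists n.
case: (ex_minnP ex_k) => k lt_k min_k; exists k; split=> //; first exact: min_k.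
by move=> i ik; rewrite leNgt; apply/negP => /min_k; rewrite leqNgt ik.
Qed.

(** If [k] is positive, the last weight gives 2^(k-1) <= h/g, so k <= 1 + log2(h/g), and each
    summand is at most the maximum. *)
Lemma number_of_weights_log2 (R : realType) (g h : rat) (k : nat) : 0 < g ->
  (forall i, (i < k)%N -> g * 2 ^+ i <= h) ->
  (k%:R : R) <= 2 * Num.max 1 (log2 (ratr (h / g))).
Proof.
move=> g0; case: k => [|k] le_h.
  by rewrite mulr_ge0 // le_max ler01.
have : 2 ^+ k <= h / g by rewrite ler_pdivlMr // mulrC le_h.
rewrite -(ler_rat R) rmorphXn rmorph_nat /= => le_ratio.
have ratio_gt0 : 0 < ratr (h / g) :> R by apply: lt_le_trans le_ratio; rewrite exprn_gt0.
have ln2 : 0 < ln (2 : R) by rewrite ln_gt0 // ltr1n.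
have k_le : (k%:R : R) <= log2 (ratr (h / g)).
  by rewrite /log2 ler_pdivlMr // mulr_natl -lnXn // ler_ln // posrE.
have max1 : 1 <= Num.max 1 (log2 (ratr (h / g))) :> R by rewrite le_max lexx.
have maxk : k%:R <= Num.max 1 (log2 (ratr (h / g))) :> R by rewrite le_max k_le orbT.
by rewrite -natr1; lra.
Qed.

(** * From weighted sum approximations to the Pareto curve *)

Lemma weighted_sum_opt_le (R : realType) (P : bicriteria_problem)
    (I x : value) (g : rat) :
  instance P I -> 0 < g -> feasible P I x ->
  weighted_sum_opt R P I g <= ratr (weighted_sum P I g x).
Proof.
move=> instI g0 feasx; apply: ge_inf; last by exists x.
(* Positivity of the objectives supplies the lower bound without which [inf] would be
   meaningless. *)
exists 0 => _ [y feasy <-]; rewrite ler0q /weighted_sum.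
by rewrite addr_ge0 ?mulr_ge0 // ltW // obj_gt0.
Qed.

Lemma weighted_sum_approx_shape (R : realType) (P : bicriteria_problem)
    (alpha : R) (I r : value) (g : rat) :
  weighted_sum_approx P alpha I g r ->
  r = enc_list [::] \/ exists x, r = enc_list [:: x].
Proof. by case=> [[_ [x [-> _ _]]]|[_ ->]]; [right; exists x | left]. Qed.

Lemma weighted_sum_approx_feasible (R : realType) (P : bicriteria_problem)
    (alpha : R) (I x : value) (g : rat) :
  weighted_sum_approx P alpha I g (enc_list [:: x]) -> feasible P I x.
Proof. by case=> [[_ [y [[->]]]]|[]]. Qed.

Lemma geometric_weights_pareto (R : realType) (P : bicriteria_problem)
    (alpha : R) (I : value) (e : rat) (k : nat) (C : seq value) :
  let g := e * LB P ord0 I / UB P ord_max I in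
  0 <= alpha -> instance P I -> 0 < e ->
  e * UB P ord0 I / LB P ord_max I < g * 2 ^+ k ->
  (forall x, List.In x C -> feasible P I x) ->
  (forall i, (i < k)%N ->
     exists2 r, weighted_sum_approx P alpha I (g * 2 ^+ i) r &
       forall x, r = enc_list [:: x] -> List.In x C) ->
  approx_pareto_curve P (alpha * (1 + 2 * ratr e)) (alpha * (1 + 2 / ratr e))
                      I [set x | List.In x C].
Proof.
move=> g alpha0 instI e0 h_lt C_feas C_approx; split=> // x feasx.
have f10 := obj_gt0 ord0 instI feasx; have f20 := obj_gt0 ord_max instI feasx.
rewrite -/(f1 _ _ _) in f10; rewrite -/(f2 _ _ _) in f20.
have /andP[l1 u1] := obj_bounds ord0 instI feasx.
have /andP[l2 u2] := obj_bounds ord_max instI feasx.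
have LB20 := LB_gt0 ord_max instI; have UB20 := UB_gt0 ord_max instI.
have LB10 := LB_gt0 ord0 instI.
have g0 : 0 < g by rewrite divr_gt0 // mulr_gt0.
(* The bounds on both objectives enclose e f1(x)/f2(x) between the first weight and the first one
   beyond the range. *)
have lo : g * 2 ^+ 0 <= e * (f1 P I x / f2 P I x).
  rewrite expr0 mulr1 /g -mulrA ler_pM2l // ler_pM //;
    by rewrite ?invr_ge0 ?lef_pV2 ?posrE // ltW.
have hi : e * (f1 P I x / f2 P I x) < g * 2 ^+ k.
  apply: le_lt_trans h_lt; rewrite -mulrA ler_pM2l // ler_pM //;
    by rewrite ?invr_ge0 ?lef_pV2 ?posrE // ltW.
have [i ik] := sequence_crossing _ (fun i => g * 2 ^+ i) _ _ lo hi.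
have [r r_approx inC] := C_approx i ik.
have w0 : 0 < g * 2 ^+ i by rewrite mulr_gt0 // exprn_gt0.
rewrite exprSr [g * (_ * 2)]mulrA; move: (g * 2 ^+ i) w0 r_approx => w w0 r_approx.
rewrite [e * _]mulrA ler_pdivlMr // ltr_pdivrMr // => /andP[w_le w_gt].
case: r_approx => [[_ [x' [r_x' feasx' x'_opt]]]|[feas0 _]]; last first.
  by have : (set0 : set value) x by rewrite -feas0.
(* The guarantee of [ALG] refers to the infimum; only the comparison with the given [x] is kept. *)
have opt_le : ratr (weighted_sum P I w x') <= alpha * ratr (weighted_sum P I w x) :> R.
  apply: le_trans x'_opt _; rewrite ler_wpM2l //.
  exact: weighted_sum_opt_le.
have f1'0 := obj_gt0 ord0 instI feasx'; have f2'0 := obj_gt0 ord_max instI feasx'.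
rewrite /weighted_sum !rmorphD !rmorphM /= in opt_le.
rewrite -(ler_rat R) !rmorphM /= in w_le.
rewrite -(ltr_rat R) !rmorphM rmorph_nat /= in w_gt.
rewrite [_ * 2]mulrC in w_gt.
have [|||||f1_le f2_le] := weighted_sum_tradeoff _ _ _ _ _ _ _ _ _ _ _ _ _
  opt_le w_le (ltW w_gt); rewrite ?ltr0q ?ler0q // ?ltW //.
exact: (ex_intro _ x' (And3 (inC _ r_x') f1_le f2_le)).
Qed.

(* A big-O needs a positive comparison function, whereas the logarithm vanishes
   when lower and upper bounds coincide; hence the maximum with 1, which is
   immaterial as soon as the ratio is at least 2. *)
Theorem theorem10 (R : realType) :
  exists c : nat,
  forall (P : bicriteria_problem) (alpha : R) (ALG : program),
    1 <= alpha -> weighted_sum_approx_algorithm P alpha ALG ->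
  exists (PC : program) (q : {poly nat}),
  forall (I : value) (eps : rat), instance P I -> 0 < eps <= 1 ->
  exists (C : seq value) (t m : nat),
    [/\ runs PC (pareto_input P I eps) (enc_list C) t m,
        approx_pareto_curve P (alpha * (1 + 2 * ratr eps))
                              (alpha * (1 + 2 / ratr eps))
                              I [set x | List.In x C],
        (m <= q.[length (pareto_input P I eps)])%N &
        forall T : nat,
          running_time_bound P ALG I (c * length (pareto_input P I eps))%N T ->
          (t%:R : R) <= c%:R * (T%:R * (1 / ratr eps)
                          * Num.max 1 (log2 (ratr (bound_ratio P I))))].
Proof.
(* The running time needs 18 + 2 * 10 = 38, and the weights need [4 * L + 1 <= c * L]; 40 serves
   both. *)
exists 40%N => P alpha ALG alpha1 [p ALGp].
(* At [L] the polynomial takes the value [N]: at most [L] rounds, each adding at most [M], where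
   [7 * L] bounds the input length of [ALG]. *)
exists (pareto_curve ALG),
  ('X * (p \Po (7%:P * 'X) + 7%:P * 'X) + (3%:P * 'X + 3%:P)) => I e instI /andP[e0 e1].
set L := length _; pose M := (p.[(7 * L)%N] + 7 * L)%N.
pose N := (L * M + (3 * L + 3))%N.
have LN : (3 * L + 3 <= N)%N by rewrite leq_addl.
have LB10 := LB_gt0 ord0 instI; have LB20 := LB_gt0 ord_max instI.
have UB10 := UB_gt0 ord0 instI; have UB20 := UB_gt0 ord_max instI.
set l1 := LB P ord0 I in LB10; set l2 := LB P ord_max I in LB20.
set u1 := UB P ord0 I in UB10; set u2 := UB P ord_max I in UB20.
have LE : L = (length I + rat_length l1 + rat_length u1 + rat_length l2
               + rat_length u2 + rat_length e + 7)%N.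
  rewrite /L /pareto_input /instance_data /= -/l1 -/l2 -/u1 -/u2; lia.
have fe := rat_length_fits _ e0.
have fl1 := rat_length_fits _ LB10; have fl2 := rat_length_fits _ LB20.
have fu1 := rat_length_fits _ UB10; have fu2 := rat_length_fits _ UB20.
set g := e * l1 / u2; set h := e * u1 / l2.
have g0 : 0 < g by rewrite divr_gt0 // mulr_gt0.
have fg : fits L g.
  by apply: fits_leq (fitsM _ _ _ _ (fitsM _ _ _ _ fe fl1) (fitsV _ _ fu2)); lia.
(* The accuracy cancels in the ratio, so the number of weights does not depend on it. *)
have hgE : h / g = bound_ratio P I.
  rewrite /bound_ratio -/l1 -/l2 -/u1 -/u2 /h /g.
  by field; rewrite !gt_eqF.
have fhg : fits L (h / g).
  rewrite hgE; apply: fits_leq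
    (fitsM _ _ _ _ (fitsM _ _ _ _ fu1 fu2) (fitsV _ _ (fitsM _ _ _ _ fl1 fl2))); lia.
have [k [kL le_h lt_h]] := number_of_weights g h L g0 fhg.
pose w i := g * 2 ^+ i.
have w0 i : 0 < w i by rewrite mulr_gt0 // exprn_gt0.
have wS i : w i.+1 = w i + w i by rewrite /w exprS mulrCA mulr_natl mulr2n.
have w_length i : (i <= k)%N -> (rat_length (w i) <= 4 * L + 1)%N.
  (* With [i <= k <= L] the size [L + i] is at most [2 * L], which gives the length [4 * L + 1]. *)
  move=> ik; have fw : fits (L + i) (w i).
    elim: i {ik} => [|i IH]; first by rewrite addn0 /w expr0 mulr1.
    by rewrite wS addnS; apply: fits_double.
  by have := fits_rat_length _ _ fw; lia.
pose D := instance_data P I.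
have DL : (length D + 1 <= L)%N by rewrite /L /pareto_input /= -/D; lia.
have ALG_run gamma : 0 < gamma -> exists r t m,
    [/\ runs ALG (Pair D (Defs.Num gamma)) r t m,
        weighted_sum_approx P alpha I gamma r
      & (m <= p.[length (Pair D (Defs.Num gamma))])%N].
  move=> gamma0; have [|r [t [m [run r_approx _ mp]]]] := ALGp (Pair D (Defs.Num gamma)).
    by exists I, gamma.
  by exists r, t, m; split=> //; apply: r_approx.
have w_input i : (i <= k)%N -> (length (Pair D (Defs.Num (w i))) <= 7 * L)%N.
  by move/w_length; rewrite -[length _]/(1 + length D + rat_length (w i))%N; lia.
have [|||||s1 [m1 exec1 m1N] [s1_0 s1_1 s1_4 s1_5 s1_3]] := prepareP I l1 u1 l2 u2 e N.
- by rewrite /N -/D -/(pareto_input P I e) -/L; lia.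
- by apply: leq_trans (fits_rat_length _ _ (fitsM _ _ _ _ fe fl1)) _; lia.
- by apply: leq_trans (fits_rat_length _ _ fg) _; lia.
- by apply: leq_trans (fits_rat_length _ _ (fitsM _ _ _ _ fe fu1)) _; lia.
- have fh := fitsM _ _ _ _ (fitsM _ _ _ _ fe fu1) (fitsV _ _ fl2).
  by apply: leq_trans (fits_rat_length _ _ fh) _; lia.
have [||||C [s2 [t2 [[m2 exec2 m2N] s2_0 [_ C_sub C_approx] t2T]]]] :=
  while_collectP ALG D (weighted_sum_approx P alpha I) h M N k w [::] s1 wS le_h lt_h
    (fun g r => weighted_sum_approx_shape R P alpha I r g).
- move=> i ik; have [r [t [m [run r_approx mp]]]] := ALG_run (w i) (w0 i).
  exists r, t, m; split=> //; apply: leq_trans mp _.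
  by apply: leq_trans (horner_nat_leq _ _ _ (w_input i (ltnW ik))) (leq_addr _ _).
- by move=> i /w_input; rewrite /M; lia.
- by rewrite /w expr0 mulr1; split.
- have kM : (k * M <= L * M)%N by rewrite leq_mul2r kL orbT.
  by rewrite /N -[length _]/1%N; move: (k * M)%N (L * M)%N kM; lia.
exists C, (17 + t2)%N, (maxn m1 m2); split.
- by exists s2 => //; apply: ExecSeq exec1 exec2.
- apply: (geometric_weights_pareto R P alpha I e k C) => //.
  + exact: le_trans ler01 alpha1.
  + by move=> x /C_sub[//|[i _ /weighted_sum_approx_feasible]].
- rewrite !(hornerD, hornerM, horner_comp, hornerX, hornerC).
  by apply: (@leq_trans N); rewrite // geq_max m1N.
move=> T T_bound.
(* The weight 1 is short enough for [T_bound], and every run takes a step. So [T] absorbs the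
   additive constants. *)
have T1 : (1 <= T)%N.
  have [r [t [m [run _ _]]]] := ALG_run 1 ltr01.
  apply: leq_trans (T_bound 1 r t m ltr01 _ run); last by rewrite rat_length1; lia.
  by case: run => s /exec_gt0.
have L40 : (4 * L + 1 <= 40 * L)%N by lia.
have {t2T} := t2T T (fun i r t m ik =>
  T_bound (w i) r t m (w0 i) (leq_trans (w_length i (ltnW ik)) L40)).
have := number_of_weights_log2 R g h k g0 le_h; rewrite hgE.
set K := Num.max _ _ => kK t2T.
have K1 : 1 <= K by rewrite le_max lexx.
have e1' : 1 <= 1 / ratr e :> R.
  by rewrite ler_pdivlMr ?ltr0q // mul1r -[1](rmorph1 (@ratr R)) ler_rat.
have t_le : (17 + t2 <= 18 * T + 10 * (k * T))%N by nia.
have T0 : 0 <= T%:R :> R by [].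
have TK : T%:R <= T%:R * K :> R by rewrite ler_peMr.
have kTK : k%:R * T%:R <= 2 * (T%:R * K) :> R.
  by rewrite mulrCA mulrC ler_wpM2l.
(* The factor 1/eps enters only here, as a weakening by a number at least 1. *)
have TKe : T%:R * K <= T%:R * (1 / ratr e) * K.
  by rewrite mulrAC ler_peMr // mulr_ge0 //; lra.
rewrite -(ler_nat R) in t_le; apply: le_trans t_le _.
by rewrite !natrD !natrM; lra.
Qed.
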